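(* Let $f_1,f_2\in H^\infty_{\mathbb{R}}(\mathbb{D})$ and suppose that there exist $g_1,g_2\in H^\infty_{\mathbb{R}}(\mathbb{D})$, with $g_1^{-1}=1/g_1\in H^\infty_{\mathbb{R}}(\mathbb{D})$, such that $$f_1(z)g_1(z)+f_2(z)g_2(z)=1\quad\text{for all } z\in\mathbb{D}.$$ Then, for all sufficiently small $\epsilon>0$, $f_1$ has the same sign on the set $\{x\in(-1,1):|f_2(x)|<\epsilon\}$.
   Context: $\mathbb{D}=\{z\in\mathbb{C}:|z|<1\}$. $H^\infty_{\mathbb{R}}(\mathbb{D})$ is the algebra of all bounded analytic functions $f$ on $\mathbb{D}$ satisfying $f(z)=\overline{f(\overline{z})}$ for all $z\in\mathbb{D}$; such $f$ take real values on $(-1,1)$. ''$f_1$ has the same sign on a set $E\subset(-1,1)$'' means that either $f_1(x)>0$ for all $x\in E$ or $f_1(x)<0$ for all $x\in E$. *)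

(* Defs.v *)
From Stdlib Require Import Reals.
From Coquelicot Require Export Coquelicot.

Open Scope R_scope.

(* The open unit disc. Functions on it are total functions [C -> C], of which
   only the values on [unit_disc] matter. *)
Definition unit_disc (z : C) : Prop := Cmod z < 1.

(* The normed module is given explicitly: [C] is also a normed module over [R]
   in Coquelicot, and differentiability is meant in the complex sense. *)
Definition analytic_on_disc (f : C -> C) : Prop :=
  forall z : C, unit_disc z -> @ex_derive C_AbsRing C_NormedModule f z.

Definition bounded_on_disc (f : C -> C) : Prop :=
  exists M : R, forall z : C, unit_disc z -> Cmod (f z) <= M.

Definition real_symmetric (f : C -> C) : Prop :=
  forall z : C, unit_disc z -> f z = Cconj (f (Cconj z)).

Definition Hinf_R (f : C -> C) : Prop :=
  analytic_on_disc f /\ bounded_on_disc f /\ real_symmetric f.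

(* [Cinv] is total, also at 0, so that "1/g belongs to
   Hinf_R" has to include that g has no zero in the disc. *)
Definition Hinf_R_unit (g : C -> C) : Prop :=
  Hinf_R g /\ (forall z : C, unit_disc z -> g z <> RtoC 0) /\
  Hinf_R (fun z => Cinv (g z)).

(* The inequalities w > 0 and w < 0 for a complex number w include that w is
   real. *)
Definition Cpos (w : C) : Prop := Im w = 0 /\ 0 < Re w.
Definition Cneg (w : C) : Prop := Im w = 0 /\ Re w < 0.

Definition same_sign_on (f : C -> C) (E : R -> Prop) : Prop :=
  (forall x : R, E x -> Cpos (f (RtoC x))) \/
  (forall x : R, E x -> Cneg (f (RtoC x))).

(* Main.v *)
Require Import Defs.
From Stdlib Require Import Reals Ranalysis5 Lra.
From Coquelicot Require Import Coquelicot.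
Open Scope R_scope.

(** On (-1,1) the function g1 is real, continuous and zero-free, hence of
    constant sign.  Where |f2| is smaller than 1 / sup |g2|, the real number
    f1 g1 = 1 - f2 g2 is positive, so f1 has the sign of g1 there. *)

Lemma unit_disc_RtoC (x : R) : -1 < x < 1 -> unit_disc (RtoC x).
Proof.
  intros Hx. unfold unit_disc. rewrite Cmod_R. apply Rabs_def1; lra.
Qed.

Lemma real_symmetric_Im (f : C -> C) (x : R) :
  real_symmetric f -> -1 < x < 1 -> Im (f (RtoC x)) = 0.
Proof.
  intros Hf Hx.
  pose proof (f_equal Im (Hf _ (unit_disc_RtoC x Hx))) as E.
  replace (Cconj (RtoC x)) with (RtoC x) in E
    by (apply injective_projections; simpl; ring).
  simpl in E. unfold Im in *. lra.
Qed.

(** The embedding is an isometry, so the same radius [d] serves on both sides. The target carries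
    the neighbourhoods of the modulus, as complex differentiability uses them. *)
Lemma RtoC_filterlim (x : R) :
  filterlim RtoC (locally x)
    (@locally (AbsRing_UniformSpace C_AbsRing) (RtoC x)).
Proof.
  intros P [d Hd]. exists d. intros y Hy. apply Hd.
  change (Cmod (RtoC y - RtoC x) < d).
  rewrite <- RtoC_minus, Cmod_R. exact Hy.
Qed.

Lemma analytic_continuity_Re (f : C -> C) (x : R) :
  analytic_on_disc f -> -1 < x < 1 ->
  continuity_pt (fun t : R => Re (f (RtoC t))) x.
Proof.
  intros Hf Hx. apply continuity_pt_filterlim.
  (* The values of [f] carry the product neighbourhoods of [C_UniformSpace], for which [Re] is the
     continuous first projection. *)
  apply (filterlim_comp _ _ _ (fun t : R => f (RtoC t)) Re _
           (@locally C_UniformSpace (f (RtoC x)))).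
  - apply (filterlim_comp _ _ _ RtoC f _
             (@locally (AbsRing_UniformSpace C_AbsRing) (RtoC x))).
    + apply RtoC_filterlim.
    + exact (ex_derive_continuous f (RtoC x) (Hf _ (unit_disc_RtoC x Hx))).
  - destruct (f (RtoC x)) as [a b]. exact (continuous_fst a b).
Qed.

(** Otherwise [u y < 0], and the intermediate value theorem gives a zero between [x] and [y]. *)
Lemma continuous_nonzero_same_sign (u : R -> R) (a b x y : R) :
  (forall t, a < t < b -> continuity_pt u t) ->
  (forall t, a < t < b -> u t <> 0) ->
  a < x < b -> a < y < b -> 0 < u x -> 0 < u y.
Proof.
  intros Hc Hn Hx Hy Hux.
  destruct (Rlt_or_le 0 (u y)) as [|Huy]; [assumption | exfalso].
  pose proof (Hn y Hy).
  destruct (Rtotal_order x y) as [Hxy | [-> | Hxy]]; [| lra |].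
  (* [IVT_interv] expects a negative value at the left end and a positive one at the right, hence
     the negation when [x < y]. *)
  - destruct (IVT_interv (fun t => - u t) x y) as [z [Hz E]]; try lra.
    + intros t Ht. apply (continuity_pt_opp u), Hc. lra.
    + apply (Hn z); lra.
  - destruct (IVT_interv u y x) as [z [Hz E]]; try lra.
    + intros t Ht. apply Hc. lra.
    + apply (Hn z); lra.
Qed.

(** The real part of [v] is at most its modulus, so [Re w = 1 - Re v] stays positive. *)
Lemma Re_pos_of_near_one (w v : C) :
  (w + v)%C = RtoC 1 -> Cmod v < 1 -> 0 < Re w.
Proof.
  intros E Hv. apply (f_equal Re) in E. unfold Re in *. simpl in E.
  pose proof (Rmax_Cmod v). pose proof (Rmax_l (Rabs (fst v)) (Rabs (snd v))).
  pose proof (Rle_abs (fst v)). lra.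
Qed.

Theorem lemma0p2 (f1 f2 : C -> C) (Hf1 : Hinf_R f1) (Hf2 : Hinf_R f2)
  (Hg : exists g1 g2 : C -> C,
      Hinf_R_unit g1 /\ Hinf_R g2 /\
      (forall z : C, unit_disc z -> (f1 z * g1 z + f2 z * g2 z)%C = RtoC 1)) :
  exists eps0 : R, 0 < eps0 /\
    forall eps : R, 0 < eps < eps0 ->
      same_sign_on f1 (fun x : R => -1 < x < 1 /\ Cmod (f2 (RtoC x)) < eps).
Proof.
  destruct Hg as [g1 [g2 [[[Ag [_ Sg]] [Ng _]] [[_ [[M HM] _]] Bez]]]].
  destruct Hf1 as [_ [_ Sf]].
  assert (HM0 : 0 <= M).
  { apply Rle_trans with (2 := HM _ (unit_disc_RtoC 0 ltac:(lra))).
    apply Cmod_ge_0. }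
  assert (Hgn : forall x, -1 < x < 1 -> Re (g1 (RtoC x)) <> 0).
  { intros x Hx E. apply (Ng _ (unit_disc_RtoC x Hx)).
    apply injective_projections; [exact E | exact (real_symmetric_Im g1 x Sg Hx)]. }
  assert (Hgc : forall x, -1 < x < 1 ->
            continuity_pt (fun t => Re (g1 (RtoC t))) x)
    by (intros x Hx; now apply analytic_continuity_Re).
  (* [M] bounds [g2] and may be 0; adding 1 keeps the threshold well defined. *)
  exists (/ (M + 1)). split; [apply Rinv_0_lt_compat; lra |].
  intros eps [_ Heps].
  assert (Hprod : forall x, -1 < x < 1 -> Cmod (f2 (RtoC x)) < eps ->
            0 < Re (f1 (RtoC x)) * Re (g1 (RtoC x))).
  { intros x Hx Hsmall.
    pose proof (unit_disc_RtoC x Hx) as Ux.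
    (* The modulus is at most [M / (M + 1)]. *)
    assert (Hv : Cmod (f2 (RtoC x) * g2 (RtoC x)) < 1).
    { rewrite Cmod_mult. pose proof (HM _ Ux).
      pose proof (Cmod_ge_0 (f2 (RtoC x))). pose proof (Cmod_ge_0 (g2 (RtoC x))).
      assert (/ (M + 1) * (M + 1) = 1) by (field; lra).
      nra. }
    pose proof (Re_pos_of_near_one _ _ (Bez _ Ux) Hv) as Hp.
    pose proof (real_symmetric_Im f1 x Sf Hx) as I1.
    pose proof (real_symmetric_Im g1 x Sg Hx) as I2.
    unfold Re, Im in *. simpl in Hp. rewrite I1, I2 in Hp. lra. }
  (* The sign of [g1] at 0 selects the alternative, before any [x] is chosen. *)
  destruct (Rlt_or_le 0 (Re (g1 (RtoC 0)))) as [H0 | H0]; [left | right];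
    intros x [Hx Hsmall]; (split; [exact (real_symmetric_Im f1 x Sf Hx) |]);
    pose proof (Hprod x Hx Hsmall).
  - assert (0 < Re (g1 (RtoC x))) by
      (apply (continuous_nonzero_same_sign (fun t => Re (g1 (RtoC t))) (-1) 1 0 x);
       auto; lra).
    nra.
  - assert (~ 0 < Re (g1 (RtoC x))).
    (* Positivity at [x] would carry back to 0, so the same lemma also settles the negative case. *)
    { intros Hp. apply (Rle_not_lt _ _ H0).
      apply (continuous_nonzero_same_sign (fun t => Re (g1 (RtoC t))) (-1) 1 x 0);
       auto; lra. }
    nra.
Qed.
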